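(* Consider the set of all real vectors $(\zeta,\tau,\beta,\nu,\omega,\psi)$ satisfying the constraints (Sec), (McC), (Par) listed in the context together with $0\le\zeta_{i,j}\le1$ for all $[i,j]\in\mathcal T$. Then for every vector in this set and every $[i,j]\in\mathcal T\setminus\{[1,N]\}$, the subvector $$\bigl((\tau_{i,j,n})_{j+1\le n\le N+1},\ (\beta_{m,i,j})_{0\le m\le i-1},\ \zeta_{i,j},\ (\psi_{i,n,m,j})_{j+1\le n\le N+1,\ 0\le m\le i-1}\bigr)$$ is contained in the convex hull of the set $S_{i,j}$ of all $(\tau,\beta,\zeta,\psi)$ (with the indices just displayed) such that $$\begin{aligned} &\psi_{i,n,m,j}=\tau_{i,j,n}\,\beta_{m,i,j}, && 0\le m\le i-1,\ j+1\le n\le N+1,\\ &\sum_{n=j+1}^{N+1}\tau_{i,j,n}=\sum_{m=0}^{i-1}\beta_{m,i,j}=\zeta_{i,j},\qquad \psi_{i,N+1,0,j}=0,\\ &\tau_{i,j,n},\ \beta_{m,i,j},\ \zeta_{i,j}\in\{0,1\}, && 0\le m\le i-1,\ j+1\le n\le N+1. \end{aligned}$$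
   Context: Let $N\ge2$ be an integer, $\mathcal T=\{[i,j]:1\le i\le j\le N\}$ and $\mathcal P=\mathcal T\setminus\{[i,i]:1\le i\le N\}$. Real variables: $\zeta_{i,j}$ for $[i,j]\in\mathcal T$; $\tau_{i,k,j}$ ($i\le k\le j-1$) and $\beta_{i,l,j}$ ($i+1\le l\le j$) for $[i,j]\in\mathcal P$; $\nu_{i,k,j}$ for $1\le i\le k\le j\le N$ and $\omega_{i,l,j}$ for $1\le i\le l\le j\le N$; $\psi_{i,n,m,j}$ for $[i,j]\in\mathcal T\setminus\{[1,N]\}$, $j+1\le n\le N+1$, $0\le m\le i-1$. Conventions: $\nu_{i,n,m}:=1$ if $n=m+1$, and $\omega_{n,m,j}:=1$ if $n=m+1$. In addition, for $[i,j]\in\mathcal T$ define $\tau_{i,j,N+1}:=\nu_{i,j+1,N}-\nu_{i,j,N}$ and $\beta_{0,i,j}:=\omega_{1,i-1,j}-\omega_{1,i,j}$. (Sec) For all $[i,j]\in\mathcal P$: $\tau_{i,k,j}=\nu_{i,k+1,j-1}-\nu_{i,k,j-1}-\nu_{i,k+1,j}+\nu_{i,k,j}$ for $i\le k\le j-1$; and $\beta_{i,l,j}=\omega_{i+1,l-1,j}-\omega_{i,l-1,j}-\omega_{i+1,l,j}+\omega_{i,l,j}$ for $i+1\le l\le j$. (McC) $\nu_{i,j,j}=\omega_{i,i,j}=1-\zeta_{i,j}$ for all $[i,j]\in\mathcal T$. For all $[i,j]\in\mathcal P$: $\max\{0,\nu_{i,k,m}+\nu_{i,n,j}-\nu_{i,n,m}\}\le\nu_{i,k,j}\le\min\{\nu_{i,k,m},\nu_{i,n,j}\}$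 for all $i\le k\le j-1$, $k\le m\le j-1$, $k+1\le n\le m+1$; and $\max\{0,\omega_{i,m,j}+\omega_{n,l,j}-\omega_{n,m,j}\}\le\omega_{i,l,j}\le\min\{\omega_{i,m,j},\omega_{n,l,j}\}$ for all $i+1\le l\le j$, $i\le m\le l-1$, $i+1\le n\le m+1$. (Par) For all $[i,j]\in\mathcal T\setminus\{[1,N]\}$: $\sum_{m=0}^{i-1}\psi_{i,n,m,j}=\tau_{i,j,n}$ for $j+1\le n\le N+1$; $\sum_{n=j+1}^{N+1}\psi_{i,n,m,j}=\beta_{m,i,j}$ for $0\le m\le i-1$; $\psi_{i,n,m,j}\ge0$ for all $j+1\le n\le N+1$, $0\le m\le i-1$; and $\psi_{i,N+1,0,j}=0$. *)

(* Defs.v *)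
From mathcomp Require Import all_boot all_order all_algebra.
From mathcomp Require Import classical_sets reals convex.
Set Implicit Arguments.
Unset Strict Implicit.
Unset Printing Implicit Defensive.
Import Order.TTheory GRing.Theory Num.Theory.
Local Open Scope classical_set_scope.
Local Open Scope ring_scope.

(* [i, j] \in T, [i, j] \in P and [i, j] \in T \ {[1, N]}; indices are 1-based. *)
Definition inT (N i j : nat) : bool := [&& 1 <= i, i <= j & j <= N]%N.
Definition inP (N i j : nat) : bool := inT N i j && (i != j).
Definition inT' (N i j : nat) : bool := inT N i j && ((i, j) != (1, N))%N.

(* A vector (zeta, tau, beta, nu, omega, psi). Subscripts are written as
   arguments, in the same order (tau i k j, beta i l j, nu i k j, omega i l j,
   psi i n m j). Components whose subscripts are not those of an actual
   variable are junk: no constraint mentions them. *)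
Record vars (R : Type) := Vars {
  zeta : nat -> nat -> R;
  tau : nat -> nat -> nat -> R;
  beta : nat -> nat -> nat -> R;
  nu : nat -> nat -> nat -> R;
  omega : nat -> nat -> nat -> R;
  psi : nat -> nat -> nat -> nat -> R }.

(* The conventions nu_{i,n,m} := 1 and omega_{n,m,j} := 1 when n = m + 1. *)
Definition nux (R : realType) (v : vars R) (i n m : nat) : R :=
  if n == m.+1 then 1 else nu v i n m.
Definition omegax (R : realType) (v : vars R) (n m j : nat) : R :=
  if n == m.+1 then 1 else omega v n m j.

(* tau and beta extended by the defined quantities tau_{i,j,N+1} and
   beta_{0,i,j}, which are not variables. *)
Definition taux (R : realType) (N : nat) (v : vars R) (i j n : nat) : R :=
  if n == N.+1 then nux v i j.+1 N - nux v i j N else tau v i j n.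
Definition betax (R : realType) (v : vars R) (m i j : nat) : R :=
  if m == 0%N then omegax v 1 i.-1 j - omegax v 1 i j else beta v m i j.

Definition Sec (R : realType) (N : nat) (v : vars R) : Prop :=
  forall i j : nat, inP N i j ->
    (forall k : nat, (i <= k <= j.-1)%N ->
       tau v i k j = nux v i k.+1 j.-1 - nux v i k j.-1
                     - nux v i k.+1 j + nux v i k j) /\
    (forall l : nat, (i.+1 <= l <= j)%N ->
       beta v i l j = omegax v i.+1 l.-1 j - omegax v i l.-1 j
                      - omegax v i.+1 l j + omegax v i l j).

Definition McC (R : realType) (N : nat) (v : vars R) : Prop :=
  (forall i j : nat, inT N i j ->
     nu v i j j = 1 - zeta v i j /\ omega v i i j = 1 - zeta v i j) /\
  (forall i j : nat, inP N i j ->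
     (forall k m n : nat,
        (i <= k <= j.-1)%N -> (k <= m <= j.-1)%N -> (k.+1 <= n <= m.+1)%N ->
        Num.max 0 (nux v i k m + nux v i n j - nux v i n m) <= nux v i k j
          <= Num.min (nux v i k m) (nux v i n j)) /\
     (forall l m n : nat,
        (i.+1 <= l <= j)%N -> (i <= m <= l.-1)%N -> (i.+1 <= n <= m.+1)%N ->
        Num.max 0 (omegax v i m j + omegax v n l j - omegax v n m j)
          <= omegax v i l j
          <= Num.min (omegax v i m j) (omegax v n l j))).

Definition Par (R : realType) (N : nat) (v : vars R) : Prop :=
  forall i j : nat, inT' N i j ->
    [/\ (forall n : nat, (j.+1 <= n <= N.+1)%N ->
           \sum_(0 <= m < i) psi v i n m j = taux N v i j n),
        (forall m : nat, (0 <= m <= i.-1)%N ->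
           \sum_(j.+1 <= n < N.+2) psi v i n m j = betax v m i j),
        (forall n m : nat, (j.+1 <= n <= N.+1)%N -> (0 <= m <= i.-1)%N ->
           0 <= psi v i n m j)
      & psi v i N.+1 0%N j = 0].

Definition feasible (R : realType) (N : nat) (v : vars R) : Prop :=
  [/\ Sec N v, McC N v, Par N v
    & forall i j : nat, inT N i j -> 0 <= zeta v i j <= 1].

(* The space of the subvectors (tau_{i,j,.}, beta_{.,i,j}, zeta_{i,j},
   psi_{i,.,.,j}). The subscript n \in {j+1, ..., N+1} is represented by
   a : 'I_(N.+1 - j) with n = j.+1 + a; the subscript m \in {0, ..., i-1} by
   m : 'I_i. *)
Notation subvec R N i j :=
  ('rV[R]_(N.+1 - j) * 'rV[R]_i * R^o * 'M[R]_(N.+1 - j, i))%type.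

Definition subvector (R : realType) (N : nat) (v : vars R) (i j : nat) :
    subvec R N i j :=
  (\row_(a < N.+1 - j) taux N v i j (j.+1 + a)%N,
   \row_(m < i) betax v m i j,
   zeta v i j,
   \matrix_(a < N.+1 - j, m < i) psi v i (j.+1 + a)%N m j).

Definition binary (R : realType) (x : R) : Prop := x = 0 \/ x = 1.

Definition Sset (R : realType) (N i j : nat) : set (subvec R N i j) :=
  [set p : subvec R N i j | let: (t, b, z, s) := p in
    [/\ forall (a : 'I_(N.+1 - j)) (m : 'I_i), s a m = t 0 a * b 0 m,
        \sum_(a < N.+1 - j) t 0 a = z /\ \sum_(m < i) b 0 m = z,
        forall (a : 'I_(N.+1 - j)) (m : 'I_i),
          (j.+1 + a)%N = N.+1 -> m = 0%N :> nat -> s a m = 0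
      & [/\ forall a : 'I_(N.+1 - j), binary (t 0 a),
            forall m : 'I_i, binary (b 0 m)
          & binary (z : R)]]].
Arguments Sset : clear implicits.

Definition convex_hull (R : realType) (E : lmodType R) (A : set E) : set E :=
  smallest (@convex_set R E) A.

(* Main.v *)
(** For fixed [i, j] the definition of tau makes the sum of tau_{i,j,n} over n
    telescope to 1 - nu_{i,j,j} = zeta_{i,j}, so by the row constraints of (Par)
    the total mass of psi is zeta_{i,j} <= 1. By the row and column constraints
    the subvector is therefore the sum over (n, m) of psi_{i,n,m,j} times the
    0/1 point with tau_n = beta_m = psi_{n,m} = zeta = 1; the missing mass
    1 - zeta_{i,j} goes to the origin, and the one pair (N+1, 0) whose 0/1 point
    lies outside S_{i,j} has weight zero. *)
Require Import Defs.
From mathcomp Require Import all_boot all_order all_algebra.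
From mathcomp Require Import interval_inference.
From mathcomp Require Import classical_sets reals convex.
Set Implicit Arguments.
Unset Strict Implicit.
Unset Printing Implicit Defensive.
Import Order.TTheory GRing.Theory Num.Theory.
Local Open Scope classical_set_scope.
Local Open Scope ring_scope.

(** Convexity after rescaling by [s + t]. This homogeneous form lets weighted sums be built by
    induction without renormalising at each step. *)
Lemma convex_set_add (R : realType) (E : lmodType R) (C : set E)
    (hC : @convex_set R E C) (s t : R) (x y : E) :
  0 <= s -> 0 <= t -> C x -> C y ->
  exists2 z, C z & s *: x + t *: y = (s + t) *: z.
Proof.
move=> s0 t0 Cx Cy; have [st0|st0] := eqVneq (s + t) 0.
  move/eqP: (st0); rewrite paddr_eq0// => /andP[/eqP-> /eqP->].
  by exists x => //; rewrite addr0 !scale0r add0r.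
have st_gt0 : 0 < s + t by rewrite lt_neqAle eq_sym st0 addr_ge0.
have p0 : 0 <= s / (s + t) by rewrite divr_ge0// addr_ge0.
have p1 : s / (s + t) <= 1 by rewrite ler_pdivrMr// mul1r lerDl.
exists (s / (s + t) *: x + (1 - s / (s + t)) *: y).
  have := hC x y (Itv01 p0 p1).
  by rewrite !inE; apply.
by rewrite scalerDr !scalerA mulrBr mulr1 mulrC divfK// [s + t]addrC addrK.
Qed.

Lemma convex_set_sum (R : realType) (E : lmodType R) (C : set E)
    (hC : @convex_set R E C) (I : finType) (w : I -> R) (x : I -> E) :
  C 0 -> (forall i, 0 <= w i) -> \sum_i w i <= 1 ->
  (forall i, w i != 0 -> C (x i)) -> C (\sum_i w i *: x i).
Proof.
move=> C0 w0 w1 Cx.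
(* Induction invariant: a partial sum is its total weight times a point of [C]. The empty sum and
   zero weights are absorbed by keeping any point of [C]. *)
have [s0 [z Cz ->]] : 0 <= \sum_i w i /\
    exists2 z, C z & \sum_i w i *: x i = (\sum_i w i) *: z.
  elim/big_rec2: _ => [|k y s _ [s0 [z Cz ->]]].
    by split=> //; exists 0 => //; rewrite scaler0.
  split; first exact: addr_ge0.
  have [wk0|wk0] := eqVneq (w k) 0.
    by exists z => //; rewrite wk0 scale0r !add0r.
  exact: convex_set_add (Cx _ wk0) Cz.
(* The missing mass is placed on the point 0 of [C]. *)
have s1 : 0 <= 1 - \sum_i w i by rewrite subr_ge0.
have [y Cy] := convex_set_add hC s0 s1 Cz C0.
by rewrite scaler0 addr0 subrKC scale1r => ->.
Qed.

Lemma sum_taux (R : realType) (N : nat) (v : vars R) (i j : nat) :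
  Sec N v -> McC N v -> inT N i j ->
  \sum_(a < N.+1 - j) taux N v i j (j.+1 + a) = zeta v i j.
Proof.
move=> hSec [hnu _] hT; have [hz _] := hnu _ _ hT.
case/and3P: hT => i1 ij jN.
(* By (Sec), the term with index [n <= N] is [f n.-1 - f n], and the one with index [N.+1] is [f N]
   by definition. What remains is [f j], whose leading term is 1 by the convention on [nux]. *)
pose f n := nux v i j.+1 n - nux v i j n.
rewrite subSn// big_ord_recr/= addSn subnKC// {2}/taux eqxx -/(f N).
rewrite (eq_bigr (fun a : 'I_(N - j) => - (f (j + a).+1 - f (j + a)%N))).
  rewrite -(big_mkord xpredT (fun a => - (f (j + a).+1 - f (j + a)%N))) sumrN.
  under eq_bigr do rewrite -addnS.
  rewrite (@telescope_sumr _ 0%N (N - j) (fun a => f (j + a)%N))// subnKC//.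
  rewrite addn0 opprB subrK /f /nux eqxx hz.
  by rewrite ltn_eqF// opprB addrC subrK.
move=> [a aN] _ /=; rewrite /taux addSn.
have jaN : (j + a < N)%N by rewrite -ltn_subRL.
rewrite (ltn_eqF (_ : (j + a).+1 < N.+1)%N)//.
(* (Sec) is used for the interval from [i] to [n = (j + a).+1], with [k = j]. *)
have hP : inP N i (j + a).+1.
  rewrite /inP /inT i1 jaN/= (leq_trans ij)/= ?(leq_trans (leq_addr a j))//.
  by rewrite ltn_eqF// ltnS (leq_trans ij)// leq_addr.
have [hk _] := hSec _ _ hP; rewrite hk; last by rewrite ij leq_addr.
by rewrite /f /= opprB opprD opprK addrA.
Qed.

Definition vertex (R : realType) (p q : nat) (u : 'I_p * 'I_q) :
    'rV[R]_p * 'rV[R]_q * R^o * 'M[R]_(p, q) :=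
  (delta_mx 0 u.1, delta_mx 0 u.2, 1, delta_mx u.1 u.2).

Lemma binary_bool (R : realType) (b : bool) : binary (b%:R : R).
Proof. by case: b; [right|left]. Qed.

Lemma Sset0 (R : realType) (N i j : nat) : Sset R N i j 0.
Proof.
split=> [a m||a m _ _|].
- by rewrite !mxE mulr0.
- by split; apply: big1 => a _; rewrite mxE.
- by rewrite mxE.
- by split=> [a|m|]; left; rewrite ?mxE.
Qed.

Lemma Sset_vertex (R : realType) (N i j : nat)
    (u : 'I_(N.+1 - j) * 'I_i) :
  ~ ((j.+1 + u.1)%N = N.+1 /\ u.2 = 0%N :> nat) ->
  Sset R N i j (vertex R u).
Proof.
case: u => a m /= am; split=> [b k||b k bN k0|].
- by rewrite !mxE -natrM mulnb.
- split.
    by rewrite (bigD1 a)//= mxE !eqxx big1 ?addr0// => b /negPf ba; rewrite mxE ba.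
  by rewrite (bigD1 m)//= mxE !eqxx big1 ?addr0// => b /negPf ba; rewrite mxE ba.
(* The only nonzero entry sits at [u], which the hypothesis keeps away from the forbidden
   position. *)
- rewrite mxE; have [ba|//] := eqVneq b a; have [km|//] := eqVneq k m.
  by case: am; rewrite -ba -km.
- by split=> [b|k|]; rewrite ?mxE; [exact: binary_bool..|right].
Qed.

(** Each unit row vector collects the weights sharing its index, so the marginals of [A] appear;
    these are the sums that (Par) prescribes. *)
Lemma sum_vertex (R : realType) (p q : nat) (A : 'M[R]_(p, q)) :
  \sum_u A u.1 u.2 *: vertex R u =
  (\row_a \sum_m A a m, \row_m \sum_a A a m, \sum_u A u.1 u.2, A).
Proof.
have pairE (S T : lmodType R) (F : 'I_p * 'I_q -> S * T) :
    \sum_u F u = (\sum_u (F u).1, \sum_u (F u).2).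
  by rewrite [LHS]surjective_pairing (raddf_sum fst) (raddf_sum snd).
rewrite !pairE; congr (_, _, _, _).
- apply/rowP => a; rewrite mxE summxE.
  rewrite -(pair_bigA _ (fun b m => (A b m *: delta_mx 0 b : 'rV_p) 0 a))/=.
  rewrite (bigD1 a)//= [X in _ + X]big1 ?addr0.
    by apply: eq_bigr => m _; rewrite !mxE !eqxx mulr1.
  by move=> b /negPf ba; apply: big1 => m _; rewrite !mxE eq_sym ba mulr0.
- apply/rowP => m; rewrite mxE summxE.
  rewrite -(pair_bigA _ (fun a k => (A a k *: delta_mx 0 k : 'rV_q) 0 m))/=.
  apply: eq_bigr => a _; rewrite (bigD1 m)//= [X in _ + X]big1 ?addr0.
    by rewrite !mxE !eqxx mulr1.
  by move=> b /negPf ba; rewrite !mxE eq_sym ba mulr0.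
- by apply: eq_bigr => u _; exact: mulr1.
- by rewrite [RHS]matrix_sum_delta pair_bigA.
Qed.

Theorem proposition4 (R : realType) (N : nat) (hN : (2 <= N)%N) (v : vars R)
    (hv : feasible N v) (i j : nat) (hij : inT' N i j) :
  convex_hull (Sset R N i j) (subvector N v i j).
Proof.
case: hv => hSec hMcC hPar hzeta.
have hT : inT N i j by case/andP: hij.
have [htau hbeta psi_ge0 psi0] := hPar _ _ hij.
case/and3P: (hT) => i1 ij jN.
have range_n (a : 'I_(N.+1 - j)) : (j.+1 <= j.+1 + a <= N.+1)%N.
  by rewrite leq_addr addSn -ltn_subRL ltn_ord.
have range_m (m : 'I_i) : (0 <= m <= i.-1)%N.
  by rewrite leq0n -ltnS prednK ?ltn_ord.
pose A := \matrix_(a < N.+1 - j, m < i) psi v i (j.+1 + a)%N m j.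
have rowA a : \sum_m A a m = taux N v i j (j.+1 + a).
  rewrite -htau// big_mkord; apply: eq_bigr => m _; exact: mxE.
have colA (m : 'I_i) : \sum_a A a m = betax v m i j.
  rewrite -hbeta// -{1}[j.+1]add0n big_addn subSS big_mkord.
  by apply: eq_bigr => a _; rewrite mxE addnC.
have sumA : \sum_u A u.1 u.2 = zeta v i j.
  rewrite -(pair_bigA _ (fun a m => A a m))/= -(sum_taux hSec hMcC hT).
  exact: eq_bigr.
have -> : subvector N v i j = \sum_u A u.1 u.2 *: vertex R u.
  rewrite sum_vertex sumA; congr (_, _, _, _).
    by apply/rowP => a; rewrite !mxE rowA.
  by apply/rowP => m; rewrite !mxE colA.
(* The hull is an intersection, so membership is tested in an arbitrary convex [C] containing
   [Sset]. *)
move=> C [convC subC]; apply: (convex_set_sum convC).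
- exact/subC/Sset0.
- by move=> u; rewrite mxE psi_ge0.
- by rewrite sumA; case/andP: (hzeta _ _ hT).
- move=> u Au; apply/subC/Sset_vertex => -[uN u0].
  by move: Au; rewrite mxE uN u0 psi0 eqxx.
Qed.
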